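(* Let $m\ge1$ be an integer and $f(z)=\sum_{n\ge0}a_nz^{-n/m}$ a Gevrey-1 series whose Borel transform $\widetilde f(\zeta)=\sum_{n\ge1}\frac{a_n\zeta^{n/m-1}}{\Gamma(n/m)}$ extends analytically to $\Omega^\star$ with $|\widetilde f(\zeta)\zeta^{\frac{m-1}{m}}|\le Ae^{B|\zeta|}$ on $\Omega^\star$ for some $A,B>0$. Let $d_n$ ($n\ge1$) be defined by: for $l=1,\dots,m$, $\widetilde g_l(\xi)=\big(\frac{\xi}{1-e^{-\xi}}\big)^{\frac lm-1}\sum_{k\ge0}\frac{a_{l+mk}\xi^k}{\Gamma(\frac lm+k)}$ (principal branch, extended holomorphically to $\Delta$) and $\widetilde g_l(-\ln s)=\sum_{j\ge0}d_{l+mj}(1-s)^j$ for $s\in D(1,1)$. Then for every $n\ge1$, $$d_n=\frac{1}{\Gamma(\frac nm)}\Big(a_n+\sum_{\substack{j\ge1,\ l\ge1\\ l+jm=n}}d_{\frac lm,j}\,a_l\Big),$$ where for $r>0$ and $j\ge1$ $$d_{r,j}=\Big(\sum_{1\le p\le j}\frac{B_{j,p}\big(\frac{1!}{2},\frac{2!}{3},\dots,\frac{i!}{i+1},\dots\big)}{\Gamma(r-p)}\Big)\frac{\Gamma(r+j)}{j!}.$$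
   Context: $\Delta$ is the image of the open disc $D(1,1)=\{s:|s-1|<1\}$ under $s\mapsto-\ln s$ (principal logarithm); $\Delta^\star=\Delta\setminus\{0\}$; $\mathbb{C}_m^\star$ is the $m$-sheeted covering of $\mathbb{C}^\star$ (points $(|x|,\arg x)$, $\arg x\in\mathbb{R}/2\pi m\mathbb{Z}$, projection $\pi(x)=|x|e^{i\arg x}$, $x^{k/m}$ of modulus $|x|^{k/m}$ and argument $\frac km\arg x$); $\Omega^\star=\pi^{-1}(\Delta^\star)$. Gevrey-1 means $|a_n|\le CK^n\Gamma(1+n/m)$. $1/\Gamma(r-p)$ denotes the (entire) reciprocal Gamma function, equal to $0$ at non-positive integers. $B_{j,p}(x_1,x_2,\dots)$ are the partial exponential Bell polynomials: $B_{j,p}=\sum\frac{j!}{\prod_{i\ge1}k_i!\,(i!)^{k_i}}\prod_{i\ge1}x_i^{k_i}$, the sum over nonnegative integers $k_1,k_2,\dots$ with $\sum_i k_i=p$ and $\sum_i ik_i=j$. *)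

(* Defs.v *)
From Stdlib Require Import Reals List Arith Factorial.
From Coquelicot Require Import Coquelicot.
Open Scope R_scope.

Definition cexp (z : C) : C := (exp (Re z) * cos (Im z), exp (Re z) * sin (Im z)).

Definition carg (z : C) : R :=
  let x := Re z in let y := Im z in
  if Rlt_dec 0 x then atan (y / x)
  else if Rlt_dec x 0 then
    (if Rle_dec 0 y then atan (y / x) + PI else atan (y / x) - PI)
  else if Rlt_dec 0 y then PI / 2
  else if Rlt_dec y 0 then - (PI / 2) else 0.

Definition clog (z : C) : C := (ln (Cmod z), carg z).

Definition cpow (z : C) (alpha : R) : C := cexp (RtoC alpha * clog z).

Definition Gamma (x : R) : R :=
  RInt_gen (fun t => Rpower t (x - 1) * exp (- t)) (at_right 0) (Rbar_locally p_infty).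

(** Entire reciprocal Gamma function on the reals:
    1/Gamma(x) = x(x+1)...(x+N-1) / Gamma(x+N) for any N with x+N>0;
    it vanishes at the non-positive integers. *)
Definition rgamma (x : R) : R :=
  let N := Z.to_nat (up (Rabs x)) in
  (fold_right Rmult 1 (map (fun i => x + INR i) (seq 0 N))) / Gamma (x + INR N).

Definition D11 (s : C) : Prop := Cmod (s - 1)%C < 1.
Definition DeltaSet (xi : C) : Prop := exists s, D11 s /\ xi = (- clog s)%C.
Definition Delta_star (xi : C) : Prop := DeltaSet xi /\ xi <> RtoC 0.

(** Points of the m-sheeted covering C^star_m are represented by log-coordinates
    w = ln|x| + i arg x, taken modulo 2 pi m i; the projection is cexp.
    A function on C^star_m is a function of w that is 2 pi m i-periodic.
    Omega_star = preimage of Delta_star corresponds to { w | Delta_star (cexp w) }. *)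
Definition Omega_star (w : C) : Prop := Delta_star (cexp w).

(** Partial exponential Bell polynomials B_{j,p}(x_1, x_2, ...).
    The index vectors (k_1,...,k_j) (k_i = 0 for i > j is forced by
    sum i k_i = j, and then each k_i <= j). *)
Fixpoint kvecs (len bound : nat) : list (list nat) :=
  match len with
  | O => nil :: nil
  | S l => flat_map (fun k => map (cons k) (kvecs l bound)) (seq 0 (S bound))
  end.

Fixpoint ksum (k : list nat) : nat :=
  match k with nil => 0%nat | c :: r => (c + ksum r)%nat end.
Fixpoint kwsum (i0 : nat) (k : list nat) : nat :=
  match k with nil => 0%nat | c :: r => (i0 * c + kwsum (S i0) r)%nat end.

Fixpoint kden (i0 : nat) (k : list nat) : R :=
  match k with nil => 1 | c :: r => INR (fact c) * (INR (fact i0)) ^ c * kden (S i0) r end.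
Fixpoint kmon (x : nat -> R) (i0 : nat) (k : list nat) : R :=
  match k with nil => 1 | c :: r => (x i0) ^ c * kmon x (S i0) r end.

Definition bell (j p : nat) (x : nat -> R) : R :=
  fold_right Rplus 0
    (map (fun k => INR (fact j) / kden 1 k * kmon x 1 k)
       (filter (fun k => andb (Nat.eqb (ksum k) p) (Nat.eqb (kwsum 1 k) j)) (kvecs j j))).

Definition bell_arg (i : nat) : R := INR (fact i) / INR (S i).

Definition drj (r : R) (j : nat) : R :=
  sum_n_m (fun p => bell j p bell_arg * rgamma (r - INR p)) 1 j
  * Gamma (r + INR j) / INR (fact j).

(* Main.v *)
Require Import Defs.
From Stdlib Require Import Reals ZArith List Lra Lia.
From Coquelicot Require Import Coquelicot.
Open Scope R_scope.

(** On the real points [s = 1 - t] with [t -> 0+], put [xi = - ln (1 - t) = t (1 + u)] with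
    [u = sum_{i >= 1} t^i / (i + 1)].  Since [1 - e^{-xi} = t], the function [g_l (- ln s)] equals
    [sum_k a_{l+mk} / Gamma (r + k) * t^k (1 + u)^(r + k - 1)] with [r = l / m].  The binomial
    expansion of [(1 + u)^(r + k - 1)], the identity
    [(r + k - 1) ... (r + k - p) / Gamma (r + k) = 1 / Gamma (r + k - p)], and
    [u^p / p! = sum_j B_{j,p} (1!/2, 2!/3, ...) t^j / j!] give the coefficient of [t^j].
    Comparing asymptotic expansions of finite order at [0+], for real and imaginary parts
    separately, avoids any rearrangement of infinite series. *)

(** * The Gamma function *)

(** [Gamma] is a value of [RInt_gen], about which nothing can be said until the improper integral is
    known to converge. Convergence yields positivity and the recurrence
    [Gamma (x + 1) = x * Gamma x], and the later arguments use no other property of [Gamma]. Real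
    points suffice because the coefficients of a convergent power series are determined by its
    values on any interval to the right of 0. On such points the principal logarithm and power are
    the real ones, so every factor that accompanies a complex coefficient is real and passes through
    the real and imaginary parts. At a fixed order N only finitely many binomial terms matter: u =
    O(t), so the remainder after u^N is O(t^(N+1)). The same uniqueness of expansions also extracts
    the Bell polynomials from the powers of a polynomial. *)

Definition gamma_integrand (x t : R) : R := Rpower t (x - 1) * exp (- t).

Lemma is_derive_Rpower_base (y t : R) : 0 < t ->
  is_derive (fun s => Rpower s y) t (y * Rpower t (y - 1)).
Proof.
  intros Ht; apply is_derive_Reals, derivable_pt_lim_power, Ht.
Qed.

Lemma continuous_Rpower_base (y t : R) : 0 < t -> continuous (fun s => Rpower s y) t.
Proof.
  intros Ht; apply (ex_derive_continuous (fun s => Rpower s y)).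
  eexists; apply is_derive_Rpower_base, Ht.
Qed.

Lemma continuous_gamma_integrand (x t : R) : 0 < t -> continuous (gamma_integrand x) t.
Proof.
  intros Ht; apply (continuous_mult (K := R_AbsRing)).
  - now apply continuous_Rpower_base.
  - apply (ex_derive_continuous (fun s => exp (- s))); auto_derive; trivial.
Qed.

Lemma gamma_integrand_pos (x t : R) : 0 < gamma_integrand x t.
Proof.
  apply Rmult_lt_0_compat; apply exp_pos.
Qed.

Lemma ex_RInt_gamma_integrand (x a b : R) : 0 < a -> 0 < b -> ex_RInt (gamma_integrand x) a b.
Proof.
  intros Ha Hb; apply (ex_RInt_continuous (V := R_CompleteNormedModule)); intros t Ht.
  apply continuous_gamma_integrand.
  apply Rlt_le_trans with (2 := proj1 Ht); now apply Rmin_glb_lt.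
Qed.

Lemma is_derive_gamma_boundary (x t : R) : 0 < t ->
  is_derive (fun s => Rpower s x * exp (- s)) t
    (x * gamma_integrand x t - gamma_integrand (x + 1) t).
Proof.
  intros Ht; unfold gamma_integrand.
  replace (x + 1 - 1) with x by ring.
  replace (x * (Rpower t (x - 1) * exp (- t)) - Rpower t x * exp (- t))
    with (plus (mult (x * Rpower t (x - 1)) (exp (- t))) (mult (Rpower t x) (- exp (- t))))
    by (unfold plus, mult; simpl; ring).
  apply (is_derive_mult (fun s => Rpower s x) (fun s => exp (- s)) t (x * Rpower t (x - 1)) (- exp (- t))).
  - now apply is_derive_Rpower_base.
  - auto_derive; trivial; ring.
  - intros n m; apply Rmult_comm.
Qed.

Lemma Rpower_le_1_plus (x t : R) : 0 < x <= 1 -> 0 < t -> Rpower t x <= 1 + t.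
Proof.
  intros Hx Ht; destruct (Rle_dec t 1) as [H|H].
  - enough (Rpower t x <= 1) by lra.
    replace 1 with (exp 0) by apply exp_0; unfold Rpower.
    assert (ln t <= 0) by (rewrite <- ln_1; apply ln_le; lra).
    assert (x * ln t <= 0) by nra.
    destruct (Req_dec (x * ln t) 0) as [->|]; [lra|left; apply exp_increasing; lra].
  - enough (Rpower t x <= Rpower t 1) by (rewrite Rpower_1 in *; lra).
    apply Rle_Rpower; lra.
Qed.

(* The integrand is at most the derivative of [(t^x - 2 - t) e^{-t} / x], which takes values in [-2/x, 0]. *)
Lemma RInt_gamma_integrand_le (x a b : R) : 0 < x <= 1 -> 0 < a -> a <= b ->
  RInt (gamma_integrand x) a b <= 2 / x.
Proof.
  intros Hx Ha Hab.
  set (Fx := fun t => Rpower t x * exp (- t) - (2 + t) * exp (- t)).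
  set (fx := fun t => x * gamma_integrand x t - gamma_integrand (x + 1) t + (1 + t) * exp (- t)).
  assert (HI : is_RInt fx a b (minus (Fx b) (Fx a))).
  { apply (is_RInt_derive (V := R_CompleteNormedModule)); rewrite Rmin_left, Rmax_right by trivial.
    - intros t Ht; unfold Fx, fx.
      replace (x * gamma_integrand x t - gamma_integrand (x + 1) t + (1 + t) * exp (- t))
        with (minus (x * gamma_integrand x t - gamma_integrand (x + 1) t) (- (1 + t) * exp (- t)))
        by (unfold minus, plus, opp; simpl; ring).
      apply (is_derive_minus (V := R_NormedModule)).
      + apply is_derive_gamma_boundary; lra.
      + auto_derive; trivial; ring.
    - intros t Ht; unfold fx.
      apply (continuous_plus (V := R_NormedModule)).
      + apply (continuous_minus (V := R_NormedModule)).
        * apply (continuous_scal_r (V := R_NormedModule)), continuous_gamma_integrand; lra.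
        * apply continuous_gamma_integrand; lra.
      + apply (ex_derive_continuous (fun s => (1 + s) * exp (- s))); auto_derive; trivial. }
  assert (Hle : RInt (fun t => x * gamma_integrand x t) a b <= RInt fx a b).
  { apply RInt_le; trivial.
    - apply (ex_RInt_scal (V := R_NormedModule)), ex_RInt_gamma_integrand; lra.
    - eexists; apply HI.
    (* The derivative of -(2 + t) e^{-t} is (1 + t) e^{-t}; since t^x <= 1 + t, it absorbs the
       negative term -t^x e^{-t}. *)
    - intros t Ht; unfold fx.
      enough (gamma_integrand (x + 1) t <= (1 + t) * exp (- t)) by lra.
      unfold gamma_integrand; replace (x + 1 - 1) with x by ring.
      apply Rmult_le_compat_r; [left; apply exp_pos|apply Rpower_le_1_plus; lra]. }
  rewrite (is_RInt_unique _ _ _ _ HI) in Hle.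
  assert (Hs : RInt (fun t => x * gamma_integrand x t) a b = x * RInt (gamma_integrand x) a b).
  { apply (RInt_scal (V := R_CompleteNormedModule)), ex_RInt_gamma_integrand; lra. }
  rewrite Hs in Hle; unfold minus, plus, opp, Fx in Hle; simpl in Hle.
  assert (Rpower b x <= 1 + b) by (apply Rpower_le_1_plus; lra).
  assert (0 < Rpower a x * exp (- a)) by (apply Rmult_lt_0_compat; apply exp_pos).
  assert (0 < exp (- b)) by apply exp_pos.
  assert (0 < exp (- a)) by apply exp_pos.
  assert (Rpower b x * exp (- b) <= (1 + b) * exp (- b)) by (apply Rmult_le_compat_r; lra).
  assert ((1 + a) * exp (- a) <= 1).
  { replace 1 with (exp a * exp (- a)) at 2 by (rewrite <- exp_plus, Rplus_opp_r; apply exp_0).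
    apply Rmult_le_compat_r; [lra|]. left; apply exp_ineq1; lra. }
  assert (0 < a * exp (- a)) by (apply Rmult_lt_0_compat; lra).
  apply Rmult_le_reg_l with x; [lra|].
  replace (x * (2 / x)) with 2 by (field; lra).
  nra.
Qed.

Lemma at_right_0_interval (e : R) : 0 < e -> at_right 0 (fun t => 0 < t < e).
Proof.
  intros He; exists (mkposreal e He); intros t Ht H0; split; trivial.
  unfold ball in Ht; simpl in Ht; unfold AbsRing_ball, abs, minus, plus, opp in Ht; simpl in Ht.
  rewrite Ropp_0, Rplus_0_r, Rabs_pos_eq in Ht; lra.
Qed.

Lemma at_right_0_p_infty_prod (a b : R) : 0 < a ->
  filter_prod (at_right 0) (Rbar_locally p_infty) (fun ab => 0 < fst ab < a /\ b < snd ab).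
Proof.
  intros Ha; apply Filter_prod with (fun t => 0 < t < a) (fun t => b < t).
  - now apply at_right_0_interval.
  - now exists b.
  - intros u v Hu Hv; split; trivial.
Qed.

(** The integrand is positive, so its integral grows with the interval; being bounded by 2 / x, it
    converges to its supremum. The constraints a < 1 and b > 2 in [E] keep the intervals
    nondegenerate. *)
Lemma is_RInt_gen_gamma_small (x : R) : 0 < x <= 1 ->
  exists L, 0 < L /\ is_RInt_gen (gamma_integrand x) (at_right 0) (Rbar_locally p_infty) L.
Proof.
  intros Hx.
  set (E := fun v => exists a b, 0 < a < 1 /\ 2 < b /\ v = RInt (gamma_integrand x) a b).
  destruct (completeness E) as [L [HL1 HL2]].
  - exists (2 / x); intros v (a & b & Ha & Hb & ->); apply RInt_gamma_integrand_le; lra.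
  - exists (RInt (gamma_integrand x) (1 / 2) 3), (1 / 2), 3; repeat split; lra.
  - exists L; split.
    + apply Rlt_le_trans with (RInt (gamma_integrand x) (1 / 2) 3).
      * apply RInt_gt_0; try lra.
        -- intros; apply gamma_integrand_pos.
        -- intros; apply continuous_gamma_integrand; lra.
      * apply HL1; exists (1 / 2), 3; repeat split; lra.
    + intros P [eps HP].
      assert (Hlt : exists v, E v /\ L - eps < v).
      { destruct (Classical_Prop.classic (exists v, E v /\ L - eps < v)) as [H|H]; trivial.
        exfalso; assert (L <= L - eps); [|destruct eps; simpl in *; lra].
        apply HL2; intros v Hv; apply Rnot_lt_le; intros Hlt; apply H; now exists v. }
      destruct Hlt as (v & (a0 & b0 & Ha0 & Hb0 & ->) & Hv).
      unfold filtermapi.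
      generalize (at_right_0_p_infty_prod a0 b0 (proj1 Ha0)); apply filter_imp.
      intros [a b] [Ha Hb]; simpl in Ha, Hb.
      exists (RInt (gamma_integrand x) a b); split.
      * apply (RInt_correct (V := R_CompleteNormedModule)), ex_RInt_gamma_integrand; simpl; lra.
      * apply HP; unfold ball; simpl; unfold AbsRing_ball, abs, minus, plus, opp; simpl.
        assert (RInt (gamma_integrand x) a b <= L)
          by (apply HL1; exists a, b; repeat split; lra).
        assert (Hc : RInt (gamma_integrand x) a b = RInt (gamma_integrand x) a a0
            + RInt (gamma_integrand x) a0 b0 + RInt (gamma_integrand x) b0 b).
        { rewrite <- (RInt_Chasles (gamma_integrand x) a b0 b);
            try (apply ex_RInt_gamma_integrand; lra).
          rewrite <- (RInt_Chasles (gamma_integrand x) a a0 b0);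
            try (apply ex_RInt_gamma_integrand; lra).
          reflexivity. }
        assert (0 <= RInt (gamma_integrand x) a a0).
        { apply RInt_ge_0; try lra. apply ex_RInt_gamma_integrand; lra.
          intros; left; apply gamma_integrand_pos. }
        assert (0 <= RInt (gamma_integrand x) b0 b).
        { apply RInt_ge_0; try lra. apply ex_RInt_gamma_integrand; lra.
          intros; left; apply gamma_integrand_pos. }
        apply Rabs_def1; destruct eps; simpl in *; lra.
Qed.

Lemma filterlim_gamma_boundary_0 (x : R) : 0 < x ->
  filterlim (fun t => Rpower t x * exp (- t)) (at_right 0) (locally 0).
Proof.
  intros Hx P [eps HP].
  assert (Hr : 0 < Rpower eps (/ x)) by apply exp_pos.
  unfold filtermap; generalize (at_right_0_interval _ Hr); apply filter_imp; intros t Ht.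
  apply HP; unfold ball; simpl; unfold AbsRing_ball, abs, minus, plus, opp; simpl.
  assert (0 < Rpower t x) by apply exp_pos.
  assert (0 < exp (- t)) by apply exp_pos.
  assert (exp (- t) < 1) by (rewrite <- exp_0; apply exp_increasing; lra).
  assert (Rpower t x < eps).
  { replace (pos eps) with (Rpower (Rpower eps (/ x)) x).
    - apply Rlt_Rpower_l; lra.
    - rewrite Rpower_mult, Rinv_l, Rpower_1 by (try lra; apply cond_pos); reflexivity. }
  rewrite Ropp_0, Rplus_0_r, Rabs_pos_eq by nra; nra.
Qed.

Lemma filterlim_gamma_boundary_p_infty (x : R) : 0 < x ->
  filterlim (fun t => Rpower t x * exp (- t)) (Rbar_locally p_infty) (locally 0).
Proof.
  intros Hx P [eps HP].
  (* From ln t <= t / (2x) + ln (2x) follows x ln t - t <= x ln (2x) - t / 2, which is below ln eps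
     exactly when t exceeds this threshold. *)
  exists (Rmax 0 (2 * (x * ln (2 * x) - ln eps))); intros t Ht.
  assert (Ht0 := Rle_lt_trans _ _ _ (Rmax_l _ _) Ht).
  assert (Ht1 := Rle_lt_trans _ _ _ (Rmax_r _ _) Ht).
  apply HP; unfold ball; simpl; unfold AbsRing_ball, abs, minus, plus, opp; simpl.
  rewrite Ropp_0, Rplus_0_r, Rabs_pos_eq
    by (left; apply Rmult_lt_0_compat; apply exp_pos).
  unfold Rpower; rewrite <- exp_plus.
  rewrite <- (exp_ln eps) at 1 by apply cond_pos.
  apply exp_increasing.
  assert (Hl : ln t <= t / (2 * x) + ln (2 * x)).
  { replace t with (t / (2 * x) * (2 * x)) at 1 by (field; lra).
    assert (0 < t / (2 * x)) by (apply Rdiv_lt_0_compat; lra).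
    rewrite ln_mult by lra.
    apply Rplus_le_compat_r.
    apply Rnot_lt_le; intros Hlt; apply exp_increasing in Hlt; rewrite exp_ln in Hlt by trivial.
    generalize (exp_ineq1 (t / (2 * x))); lra. }
  apply Rmult_le_compat_l with (r := x) in Hl; [|lra].
  replace (x * (t / (2 * x) + ln (2 * x))) with (t / 2 + x * ln (2 * x)) in Hl by (field; lra).
  lra.
Qed.

(** Integration by parts: the derivative of t^x e^{-t} integrates to 0 - 0, and subtracting it from
    x times one integrand leaves the other. *)
Lemma is_RInt_gen_gamma_step (x L : R) : 0 < x ->
  is_RInt_gen (gamma_integrand x) (at_right 0) (Rbar_locally p_infty) L ->
  is_RInt_gen (gamma_integrand (x + 1)) (at_right 0) (Rbar_locally p_infty) (x * L).
Proof.
  intros Hx HL.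
  set (Fx := fun t => Rpower t x * exp (- t)).
  assert (Hpos : forall ab : R * R, 0 < fst ab < 1 /\ 1 < snd ab -> forall t,
      Rmin (fst ab) (snd ab) <= t <= Rmax (fst ab) (snd ab) -> 0 < t).
  { intros [a b] [H1 H2] t [Ht _]; simpl in *.
    apply Rlt_le_trans with (2 := Ht); apply Rmin_glb_lt; lra. }
  assert (HB : is_RInt_gen (Derive Fx) (at_right 0) (Rbar_locally p_infty) (0 - 0)).
  { apply is_RInt_gen_Derive.
    - generalize (at_right_0_p_infty_prod 1 1 Rlt_0_1); apply filter_imp; intros ab H t Ht.
      eexists; apply is_derive_gamma_boundary, (Hpos ab H t Ht).
    - generalize (at_right_0_p_infty_prod 1 1 Rlt_0_1); apply filter_imp; intros ab H t Ht.
      assert (H0 := Hpos ab H t Ht).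
      apply continuous_ext_loc with (fun s => x * gamma_integrand x s - gamma_integrand (x + 1) s).
      + exists (mkposreal t H0); intros s Hs.
        symmetry; apply is_derive_unique, is_derive_gamma_boundary.
        unfold ball in Hs; simpl in Hs; unfold AbsRing_ball, abs, minus, plus, opp in Hs; simpl in Hs.
        apply Rabs_def2 in Hs; lra.
      + apply (continuous_minus (V := R_NormedModule)).
        * now apply (continuous_scal_r (V := R_NormedModule)), continuous_gamma_integrand.
        * now apply continuous_gamma_integrand.
    - now apply filterlim_gamma_boundary_0.
    - now apply filterlim_gamma_boundary_p_infty. }
  apply (is_RInt_gen_scal _ x) in HL.
  assert (H := is_RInt_gen_minus _ _ _ _ HL HB).
  replace (x * L) with (minus (scal x L) (0 - 0))
    by (unfold minus, plus, opp, scal; simpl; unfold mult; simpl; ring).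
  revert H; apply is_RInt_gen_ext.
  generalize (at_right_0_p_infty_prod 1 1 Rlt_0_1); apply filter_imp; intros ab H t Ht.
  assert (H0 : 0 < t) by (apply (Hpos ab H t); lra).
  assert (HD : Derive Fx t = x * gamma_integrand x t - gamma_integrand (x + 1) t)
    by now apply is_derive_unique, is_derive_gamma_boundary.
  rewrite HD.
  unfold minus, plus, opp, scal; simpl; unfold mult; simpl; ring.
Qed.

Lemma is_RInt_gen_gamma (x : R) : 0 < x ->
  exists L, 0 < L /\ is_RInt_gen (gamma_integrand x) (at_right 0) (Rbar_locally p_infty) L.
Proof.
  (* The recurrence carries convergence from (0, 1] to (0, 1 + n] one unit at a time. *)
  assert (H : forall n x, 0 < x <= 1 + INR n ->
    exists L, 0 < L /\ is_RInt_gen (gamma_integrand x) (at_right 0) (Rbar_locally p_infty) L).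
  { induction n as [|n IH]; intros y Hy.
    - apply is_RInt_gen_gamma_small; simpl in Hy; lra.
    - rewrite S_INR in Hy; destruct (Rle_dec y 1) as [H|H].
      + apply is_RInt_gen_gamma_small; lra.
      + destruct (IH (y - 1)) as (L & HL & HI); [lra|].
        exists ((y - 1) * L); split; [apply Rmult_lt_0_compat; lra|].
        replace y with (y - 1 + 1) at 1 by ring.
        apply is_RInt_gen_gamma_step; trivial; lra. }
  intros Hx; destruct (nfloor_ex x) as [n Hn]; [lra|].
  apply (H n); lra.
Qed.

Lemma Gamma_eq (x L : R) :
  is_RInt_gen (gamma_integrand x) (at_right 0) (Rbar_locally p_infty) L -> Gamma x = L.
Proof.
  apply (is_RInt_gen_unique (V := R_CompleteNormedModule)).
Qed.

Lemma Gamma_pos (x : R) : 0 < x -> 0 < Gamma x.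
Proof.
  intros Hx; destruct (is_RInt_gen_gamma x Hx) as (L & HL & HI).
  now rewrite (Gamma_eq _ _ HI).
Qed.

Lemma Gamma_plus_1 (x : R) : 0 < x -> Gamma (x + 1) = x * Gamma x.
Proof.
  intros Hx; destruct (is_RInt_gen_gamma x Hx) as (L & _ & HI).
  rewrite (Gamma_eq _ _ HI).
  now apply Gamma_eq, is_RInt_gen_gamma_step.
Qed.

(** * Factorial products and the reciprocal Gamma function *)

Fixpoint falling (x : R) (p : nat) : R :=
  match p with O => 1 | S p' => falling x p' * (x - INR p') end.

Definition rising (x : R) (N : nat) : R := fold_right Rmult 1 (map (fun i => x + INR i) (seq 0 N)).

Lemma rising_S (x : R) (N : nat) : rising x (S N) = rising x N * (x + INR N).
Proof.
  unfold rising; rewrite seq_S, map_app; simpl.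
  induction (map (fun i => x + INR i) (seq 0 N)) as [|y l IH]; simpl; [ring|rewrite IH; ring].
Qed.

Lemma rising_S_l (x : R) (N : nat) : rising x (S N) = x * rising (x + 1) N.
Proof.
  unfold rising; simpl; rewrite Rplus_0_r; f_equal; f_equal.
  rewrite <- seq_shift, map_map; apply map_ext; intros i; rewrite S_INR; ring.
Qed.

(** Both sides are the product of x - p, ..., x - 1, read in opposite orders. *)
Lemma rising_falling (x : R) (p : nat) : rising (x - INR p) p = falling (x - 1) p.
Proof.
  induction p as [|p IH]; [reflexivity|].
  rewrite rising_S_l; simpl falling; rewrite <- IH, S_INR.
  replace (x - (INR p + 1) + 1) with (x - INR p) by ring; ring.
Qed.

(** The quotient defining [rgamma] is the same for all shifts that make the argument positive, by
    the recurrence of [Gamma]. *)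
Lemma rising_div_Gamma (x : R) (N k : nat) : 0 < x + INR N ->
  rising x (N + k) / Gamma (x + INR (N + k)) = rising x N / Gamma (x + INR N).
Proof.
  intros HN; induction k as [|k IH]; [now rewrite Nat.add_0_r|].
  rewrite Nat.add_succ_r, rising_S, S_INR, <- IH.
  assert (0 < x + INR (N + k)) by (rewrite plus_INR; generalize (pos_INR k); lra).
  rewrite <- Rplus_assoc, Gamma_plus_1 by trivial.
  assert (0 < Gamma (x + INR (N + k))) by now apply Gamma_pos.
  field; lra.
Qed.

(** For the argument r - p the shift p is as admissible as the one built into [rgamma]; both are
    compared with their sum. When r is an integer at most p, the falling product contains the factor
    0, in agreement with the zeros of 1/Gamma. *)
Lemma rgamma_falling (r : R) (p : nat) : 0 < r -> rgamma (r - INR p) = falling (r - 1) p / Gamma r.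
Proof.
  intros Hr; unfold rgamma; fold (rising (r - INR p) (Z.to_nat (up (Rabs (r - INR p))))).
  set (x := r - INR p); set (N := Z.to_nat (up (Rabs x))).
  assert (HN : 0 < x + INR N).
  { destruct (archimed (Rabs x)) as [H _].
    assert (0 <= up (Rabs x))%Z by (apply le_IZR; generalize (Rabs_pos x); simpl; lra).
    unfold N; rewrite INR_IZR_INZ, Z2Nat.id by trivial.
    generalize (Rabs_maj2 x); lra. }
  assert (Hp : 0 < x + INR p) by (unfold x; lra).
  rewrite <- (rising_div_Gamma x N p HN), Nat.add_comm, (rising_div_Gamma x p N Hp).
  unfold x; rewrite rising_falling; f_equal; f_equal; ring.
Qed.

(** * Asymptotic expansions at 0+ *)

(* [f t = sum_{n < N} c n * t ^ n + O(t ^ N)] as [t -> 0+], peeling off one coefficient at a time. *)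
Fixpoint asym (N : nat) (f : R -> R) (c : nat -> R) : Prop :=
  match N with
  | O => exists M, at_right 0 (fun t => Rabs (f t) <= M)
  | S N' => exists g, at_right 0 (fun t => f t = c O + t * g t) /\ asym N' g (fun n => c (S n))
  end.

Lemma asym_ext (N : nat) : forall f g c e, at_right 0 (fun t => f t = g t) ->
  (forall n, (n < N)%nat -> c n = e n) -> asym N f c -> asym N g e.
Proof.
  induction N as [|N IH]; simpl; intros f g c e Hfg Hce.
  - intros [M HM]; exists M; generalize (filter_and _ _ Hfg HM); apply filter_imp.
    intros t [<- H]; exact H.
  - intros (h & Hh & HN); exists h; split.
    + generalize (filter_and _ _ Hfg Hh); apply filter_imp; intros t [<- ->].
      rewrite Hce by lia; reflexivity.
    + revert HN; apply IH; [now apply filter_forall|intros n Hn; apply Hce; lia].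
Qed.

Lemma asym_bounded (N : nat) : forall f c, asym N f c -> asym 0 f c.
Proof.
  induction N as [|N IH]; intros f c; [trivial|].
  intros (g & Hg & HN); destruct (IH _ _ HN) as [M HM].
  exists (Rabs (c O) + M).
  generalize (filter_and _ _ (at_right_0_interval 1 Rlt_0_1) (filter_and _ _ Hg HM)).
  apply filter_imp; intros t (Ht & -> & H).
  eapply Rle_trans; [apply Rabs_triang|]; apply Rplus_le_compat_l.
  rewrite Rabs_mult, (Rabs_pos_eq t) by lra.
  generalize (Rabs_pos (g t)); nra.
Qed.

Lemma asym_weaken (N : nat) : forall f c, asym (S N) f c -> asym N f c.
Proof.
  induction N as [|N IH]; intros f c.
  - apply asym_bounded.
  - intros (g & Hg & HN); exists g; split; [trivial|]; now apply IH.
Qed.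

Lemma asym_plus (N : nat) : forall f g c e, asym N f c -> asym N g e ->
  asym N (fun t => f t + g t) (fun n => c n + e n).
Proof.
  induction N as [|N IH]; intros f g c e.
  - intros [M HM] [M' HM']; exists (M + M').
    generalize (filter_and _ _ HM HM'); apply filter_imp; intros t [H H'].
    eapply Rle_trans; [apply Rabs_triang|]; lra.
  - intros (h & Hh & HN) (h' & Hh' & HN'); exists (fun t => h t + h' t); split.
    + generalize (filter_and _ _ Hh Hh'); apply filter_imp; intros t [-> ->]; ring.
    + exact (IH _ _ _ _ HN HN').
Qed.

Lemma asym_scal (N : nat) (k : R) : forall f c, asym N f c ->
  asym N (fun t => k * f t) (fun n => k * c n).
Proof.
  induction N as [|N IH]; intros f c.
  - intros [M HM]; exists (Rabs k * M); revert HM; apply filter_imp; intros t H.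
    rewrite Rabs_mult; apply Rmult_le_compat_l; [apply Rabs_pos|trivial].
  - intros (h & Hh & HN); exists (fun t => k * h t); split.
    + revert Hh; apply filter_imp; intros t ->; ring.
    + exact (IH _ _ HN).
Qed.

Lemma asym_sum (N n : nat) (F : nat -> R -> R) (c : nat -> nat -> R) :
  (forall i, asym N (F i) (c i)) ->
  asym N (fun t => sum_f_R0 (fun i => F i t) n) (fun j => sum_f_R0 (fun i => c i j) n).
Proof.
  intros H; induction n as [|n IH]; simpl; [apply H|].
  apply asym_plus; [apply IH|apply H].
Qed.

Lemma asym_const (N : nat) (k : R) :
  asym N (fun _ => k) (fun n => match n with O => k | S _ => 0 end).
Proof.
  revert k; induction N as [|N IH]; intros k.
  - exists (Rabs k); apply filter_forall; intros _; lra.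
  - exists (fun _ => 0); split; [apply filter_forall; intros t; ring|].
    generalize (IH 0); apply asym_ext; [now apply filter_forall|now intros [|n] _].
Qed.

Lemma asym_small (N : nat) (M : R) : forall f, at_right 0 (fun t => Rabs (f t) <= M * t ^ N) ->
  asym N f (fun _ => 0).
Proof.
  induction N as [|N IH]; intros f H.
  - exists M; revert H; apply filter_imp; intros t; simpl; lra.
  - exists (fun t => f t / t); split.
    + generalize (at_right_0_interval 1 Rlt_0_1); apply filter_imp; intros t Ht; field; lra.
    + apply IH; generalize (filter_and _ _ H (at_right_0_interval 1 Rlt_0_1)).
      apply filter_imp; intros t [Hf Ht].
      unfold Rdiv; rewrite Rabs_mult, Rabs_inv, (Rabs_pos_eq t) by lra.
      apply Rmult_le_reg_r with t; [lra|].
      rewrite Rmult_assoc, Rinv_l, Rmult_1_r by lra.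
      simpl in Hf; lra.
Qed.

(** Two leading coefficients differ by t times a bounded function, hence agree; then the two
    remainders coincide near 0+, and the induction applies to them. *)
Lemma asym_unique (N : nat) : forall f c e, asym N f c -> asym N f e ->
  forall n, (n < N)%nat -> c n = e n.
Proof.
  induction N as [|N IH]; intros f c e; [lia|].
  intros (g & Hg & HN) (h & Hh & HN').
  destruct (asym_bounded _ _ _ HN) as [M HM]; destruct (asym_bounded _ _ _ HN') as [M' HM'].
  assert (H0 : c O = e O).
  { destruct (Req_dec (c O) (e O)) as [H|H]; [trivial|exfalso].
    assert (Hp : 0 < Rabs (c O - e O)) by (apply Rabs_pos_lt; lra).
    (* [K] bounds |h - g|, so any t below |c 0 - e 0| / K contradicts c 0 - e 0 = t (h t - g t). The
       added 1 only makes [K] positive. *)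
    set (K := Rabs M + Rabs M' + 1).
    assert (HK : 0 < K) by (unfold K; generalize (Rabs_pos M) (Rabs_pos M'); lra).
    assert (Hq : 0 < Rabs (c O - e O) / K) by now apply Rdiv_lt_0_compat.
    destruct (filter_ex _ (filter_and _ _ (filter_and _ _ Hg Hh) (filter_and _ _
      (filter_and _ _ HM HM') (at_right_0_interval _ Hq)))) as (t & (H1 & H2) & (H3 & H4) & Ht).
    assert (He : c O - e O = t * (h t - g t)) by lra.
    assert (Hb : Rabs (h t - g t) <= K).
    { eapply Rle_trans; [apply Rabs_triang|]; rewrite Rabs_Ropp.
      unfold K; generalize (Rle_abs M) (Rle_abs M'); lra. }
    assert (Hc : Rabs (c O - e O) <= t * K).
    { rewrite He, Rabs_mult, (Rabs_pos_eq t) by lra; apply Rmult_le_compat_l; lra. }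
    assert (Ht2 := Rmult_lt_compat_r K _ _ HK (proj2 Ht)).
    unfold Rdiv in Ht2; rewrite Rmult_assoc, Rinv_l in Ht2 by lra; lra. }
  intros [|n] Hn; [trivial|].
  apply (IH g (fun n => c (S n)) (fun n => e (S n)) HN); [|lia].
  revert HN'; apply asym_ext; [|trivial].
  generalize (filter_and _ _ (filter_and _ _ Hg Hh) (at_right_0_interval 1 Rlt_0_1)).
  apply filter_imp; intros t [[H1 H2] Ht].
  apply Rmult_eq_reg_l with t; lra.
Qed.

(** The Cauchy product, by recursion on shifts of [c] so that it follows the peeling in [asym]. *)
Fixpoint conv (c e : nat -> R) (n : nat) : R :=
  match n with
  | O => c O * e O
  | S n' => c O * e n + conv (fun i => c (S i)) e n'
  end.

(** With f = c 0 + t h and g = e 0 + t k, one has f g = c 0 e 0 + t (c 0 k + h g). The second factor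
    of h g stays unpeeled, so g is needed at the lower order too. *)
Lemma asym_mult (N : nat) : forall f g c e, asym N f c -> asym N g e ->
  asym N (fun t => f t * g t) (conv c e).
Proof.
  induction N as [|N IH]; intros f g c e Hf Hg.
  - destruct Hf as [M HM], Hg as [M' HM']; exists (M * M').
    generalize (filter_and _ _ HM HM'); apply filter_imp; intros t [H H'].
    rewrite Rabs_mult; apply Rmult_le_compat; trivial; apply Rabs_pos.
  - assert (Hg' := asym_weaken _ _ _ Hg).
    destruct Hf as (h & Hh & HN), Hg as (k & Hk & HN').
    exists (fun t => c O * k t + h t * g t); split.
    + generalize (filter_and _ _ Hh Hk); apply filter_imp; simpl; intros t [-> H].
      rewrite Rmult_plus_distr_r; rewrite H at 1; ring.
    + apply (asym_plus N (fun t => c O * k t) (fun t => h t * g t) (fun n => c O * e (S n))).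
      * now apply (asym_scal N (c O) k (fun n => e (S n))).
      * now apply IH.
Qed.

Fixpoint conv_pow (c : nat -> R) (p : nat) : nat -> R :=
  match p with
  | O => fun n => match n with O => 1 | S _ => 0 end
  | S p' => conv c (conv_pow c p')
  end.

Lemma asym_pow (N p : nat) f c : asym N f c -> asym N (fun t => f t ^ p) (conv_pow c p).
Proof.
  intros H; induction p as [|p IH]; simpl.
  - apply asym_const.
  - now apply asym_mult.
Qed.

Lemma conv_low (q n : nat) : forall c e, (forall i, (i < q)%nat -> e i = 0) -> (n < q)%nat ->
  conv c e n = 0.
Proof.
  induction n as [|n IH]; intros c e He Hn; simpl.
  - rewrite He by trivial; ring.
  - rewrite He, IH by (trivial; lia); ring.
Qed.

(** The p-th power of a series without constant term starts at t^p; this makes the binomial sums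
    finite in each degree. *)
Lemma conv_pow_low (c : nat -> R) (p : nat) : c O = 0 ->
  forall n, (n < p)%nat -> conv_pow c p n = 0.
Proof.
  intros Hc; induction p as [|p IH]; intros n Hn; [lia|]; simpl.
  destruct n as [|n]; simpl; rewrite Hc; [ring|].
  rewrite (conv_low p) by (trivial; lia); ring.
Qed.

(** * Expansions of power series, of the logarithm and of real powers *)

Lemma PSeries_bounded_near_0 (b : nat -> R) : Rbar_lt 0 (CV_radius b) ->
  exists M e, 0 < e /\ forall x, Rabs x < e -> Rabs (PSeries b x) <= M.
Proof.
  intros Hb.
  assert (Hc : continuity_pt (PSeries b) 0)
    by (apply PSeries_continuity; now rewrite Rabs_R0).
  apply continuity_pt_filterlim in Hc.
  destruct (Hc (fun y => Rabs (y - PSeries b 0) < 1)) as [e He].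
  - exists (mkposreal 1 Rlt_0_1); intros y Hy; exact Hy.
  - exists (Rabs (PSeries b 0) + 1), e; split; [apply cond_pos|intros x Hx].
    assert (H : Rabs (PSeries b x - PSeries b 0) < 1).
    { apply He; unfold ball; simpl; unfold AbsRing_ball, abs, minus, plus, opp; simpl.
      now rewrite Ropp_0, Rplus_0_r. }
    generalize (Rabs_triang_inv (PSeries b x) (PSeries b 0)); lra.
Qed.

Lemma ex_pseries_near_0 (b : nat -> R) : Rbar_lt 0 (CV_radius b) ->
  exists e, 0 < e /\ forall x, Rabs x < e -> ex_pseries b x.
Proof.
  intros Hb.
  assert (He : exists e : R, 0 < e /\ Rbar_le e (CV_radius b)).
  { destruct (CV_radius b) as [r| |]; simpl in Hb.
    - exists r; split; [trivial|apply Rbar_le_refl].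
    - exists 1; split; [lra|exact I].
    - contradiction. }
  destruct He as (e & He & Hle); exists e; split; [trivial|intros x Hx].
  apply CV_radius_inside; eapply Rbar_lt_le_trans; [|exact Hle]; exact Hx.
Qed.

Lemma asym_PSeries (N : nat) : forall b, Rbar_lt 0 (CV_radius b) -> asym N (PSeries b) b.
Proof.
  induction N as [|N IH]; intros b Hb.
  - destruct (PSeries_bounded_near_0 b Hb) as (M & e & He & H); exists M.
    generalize (at_right_0_interval e He); apply filter_imp; intros t Ht.
    apply H; rewrite Rabs_pos_eq; lra.
  - exists (PSeries (PS_decr_1 b)); split.
    + destruct (ex_pseries_near_0 b Hb) as (e & He & H).
      generalize (at_right_0_interval e He); apply filter_imp; intros t Ht.
      apply PSeries_decr_1, H; rewrite Rabs_pos_eq; lra.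
    + apply (IH (PS_decr_1 b)); now rewrite CV_radius_decr_1.
Qed.

(** Outside the disk of convergence the terms do not tend to 0, so a point of convergence bounds the
    radius from below. *)
Lemma CV_radius_pos_of_is_pseries (b : nat -> R) (x l : R) : 0 < x -> is_pseries b x l ->
  Rbar_lt 0 (CV_radius b).
Proof.
  intros Hx Hs; apply is_pseries_R in Hs.
  apply Rbar_lt_le_trans with (Finite x); [exact Hx|].
  apply Rbar_not_lt_le; intros Hlt.
  apply (CV_disk_outside b x); [rewrite Rabs_pos_eq; trivial; lra|].
  apply ex_series_lim_0; now exists l.
Qed.

(** Termwise integration of the geometric series of 1 / (1 - x). *)
Lemma ln_pseries (t : R) : -1 < t < 1 ->
  is_pseries (PS_Int (fun _ => 1)) t (- ln (1 - t)).
Proof.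
  intros Ht.
  assert (HCV : forall x, -1 < x < 1 -> is_pseries (fun _ => 1) x (/ (1 - x))).
  { intros x Hx; apply is_pseries_R.
    apply is_series_ext with (fun n => x ^ n); [intros n; symmetry; apply Rmult_1_l|].
    apply is_series_geom, Rabs_def1; lra. }
  assert (Hr : forall x, -1 < x < 1 -> Rbar_lt (Rabs x) (CV_radius (fun _ => 1))).
  { intros x Hx; set (y := (Rabs x + 1) / 2).
    assert (Hax : Rabs x < 1) by (apply Rabs_def1; lra).
    assert (Hy : Rabs x < y < 1) by (unfold y; lra).
    apply Rbar_lt_le_trans with (Finite y); [apply Hy|].
    apply Rbar_not_lt_le; intros Hlt; assert (H0 := Rabs_pos x).
    apply (CV_disk_outside (fun _ => 1) y); [rewrite (Rabs_pos_eq y); trivial; lra|].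
    apply ex_series_lim_0; exists (/ (1 - y)); apply is_pseries_R, HCV; lra. }
  replace (- ln (1 - t)) with (RInt (PSeries (fun _ => 1)) 0 t).
  - apply is_pseries_RInt, Hr, Ht.
  - assert (Hin : forall x, Rmin 0 t <= x <= Rmax 0 t -> -1 < x < 1).
    { intros x [H1 H2]; split.
      - apply Rlt_le_trans with (2 := H1); apply Rmin_glb_lt; lra.
      - apply Rle_lt_trans with (1 := H2); apply Rmax_lub_lt; lra. }
    apply is_RInt_unique.
    replace (- ln (1 - t)) with (minus (- ln (1 - t)) (- ln (1 - 0)))
      by (unfold minus, plus, opp; simpl; rewrite Rminus_0_r, ln_1; ring).
    apply (is_RInt_derive (V := R_CompleteNormedModule) (fun x => - ln (1 - x))).
    + intros x Hx; apply Hin in Hx.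
      rewrite (is_pseries_unique _ _ _ (HCV x Hx)).
      auto_derive; [lra|field; lra].
    + intros x Hx; apply continuity_pt_filterlim, PSeries_continuity, Hr, Hin, Hx.
Qed.

Lemma asym_ln (N : nat) : asym N (fun t => - ln (1 - t) / t) (fun n => / INR (S n)).
Proof.
  (* One order more than required: the constant term of -ln (1 - t) is 0, so its first remainder is
     the quotient by t. *)
  assert (H : asym (S N) (PSeries (PS_Int (fun _ => 1))) (PS_Int (fun _ => 1))).
  { apply asym_PSeries, (CV_radius_pos_of_is_pseries _ (1 / 2) _ ltac:(lra) (ln_pseries (1 / 2) ltac:(lra))). }
  destruct H as (g & Hg & HN); revert HN; apply asym_ext.
  - generalize (filter_and _ _ Hg (at_right_0_interval 1 Rlt_0_1)).
    apply filter_imp; intros t [H Ht].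
    rewrite (is_pseries_unique _ _ _ (ln_pseries t ltac:(lra))) in H.
    simpl in H; rewrite H; field; lra.
  - intros n _; simpl PS_Int; unfold Rdiv; apply Rmult_1_l.
Qed.

Lemma is_derive_n_Rpower (alpha : R) (p : nat) : forall x, -1 < x ->
  is_derive_n (fun y => Rpower (1 + y) alpha) p x
    (falling alpha p * Rpower (1 + x) (alpha - INR p)).
Proof.
  induction p as [|p IH]; intros x Hx.
  - simpl; rewrite Rminus_0_r; ring.
  - rewrite S_INR; simpl.
    apply is_derive_ext_loc with (fun y => falling alpha p * Rpower (1 + y) (alpha - INR p)).
    + assert (H0 : 0 < x + 1) by lra; exists (mkposreal _ H0); intros y Hy.
      symmetry; apply is_derive_n_unique, IH.
      unfold ball in Hy; simpl in Hy; unfold AbsRing_ball, abs, minus, plus, opp in Hy; simpl in Hy.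
      apply Rabs_def2 in Hy; lra.
    + rewrite Rmult_assoc.
      apply (is_derive_scal (fun y => Rpower (1 + y) (alpha - INR p))).
      replace (alpha - (INR p + 1)) with (alpha - INR p - 1) by ring.
      replace ((alpha - INR p) * Rpower (1 + x) (alpha - INR p - 1))
        with (scal 1 ((alpha - INR p) * Rpower (1 + x) (alpha - INR p - 1)))
        by (unfold scal; simpl; unfold mult; simpl; ring).
      apply (is_derive_comp (fun y => Rpower y (alpha - INR p)) (fun y => 1 + y)).
      * apply is_derive_Rpower_base; lra.
      * auto_derive; trivial; ring.
Qed.

Lemma Rpower_binomial_remainder (alpha : R) (n : nat) : exists K, forall x, 0 < x < 1 ->
  Rabs (Rpower (1 + x) alpha - sum_f_R0 (fun p => falling alpha p / INR (fact p) * x ^ p) n)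
    <= K * x ^ S n.
Proof.
  set (beta := alpha - INR (S n)).
  (* In the Lagrange remainder 1 / (n+1)! is at most 1, and (1 + z)^beta is at most 2^|beta| for 0 <
     z < 1, whatever the sign of beta. *)
  exists (Rabs (falling alpha (S n)) * exp (Rabs beta * ln 2)); intros x Hx.
  destruct (Taylor_Lagrange (fun y => Rpower (1 + y) alpha) n 0 x) as (z & Hz & ->).
  - lra.
  - intros t Ht k _; destruct k; [exact I|].
    eexists; apply (is_derive_n_Rpower alpha (S k)); lra.
  - rewrite (is_derive_n_unique _ _ _ _ (is_derive_n_Rpower alpha (S n) z ltac:(lra))).
    rewrite (sum_eq _ (fun p => falling alpha p / INR (fact p) * x ^ p)).
    + rewrite Rminus_0_r; fold beta.
      set (s := sum_f_R0 _ _); replace (s + _ - s) with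
        (/ INR (fact (S n)) * (falling alpha (S n) * Rpower (1 + z) beta) * x ^ S n)
        by (unfold Rdiv; ring).
      rewrite Rabs_mult, (Rabs_pos_eq (x ^ S n)) by (apply pow_le; lra).
      apply Rmult_le_compat_r; [apply pow_le; lra|].
      rewrite !Rabs_mult, Rabs_inv, (Rabs_pos_eq (INR _)) by apply pos_INR.
      rewrite (Rabs_pos_eq (Rpower _ _)) by (left; apply exp_pos).
      rewrite <- (Rmult_1_l (Rabs (falling alpha (S n)) * exp _)).
      apply Rmult_le_compat.
      * left; apply Rinv_0_lt_compat, INR_fact_lt_0.
      * apply Rmult_le_pos; [apply Rabs_pos|left; apply exp_pos].
      * rewrite <- Rinv_1; apply Rinv_le_contravar; [lra|].
        apply (le_INR 1), lt_O_fact.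
      * apply Rmult_le_compat_l; [apply Rabs_pos|]; unfold Rpower.
        assert (H1 : 0 < ln (1 + z)) by (rewrite <- ln_1; apply ln_increasing; lra).
        assert (H2 : ln (1 + z) < ln 2) by (apply ln_increasing; lra).
        assert (H3 : beta * ln (1 + z) <= Rabs beta * ln 2)
          by (generalize (Rle_abs beta) (Rabs_pos beta); nra).
        destruct H3 as [H3| ->]; [left; now apply exp_increasing|lra].
    + intros p _; rewrite (is_derive_n_unique _ _ _ _ (is_derive_n_Rpower alpha p 0 ltac:(lra))).
      rewrite Rminus_0_r, Rplus_0_r.
      assert (H1 : Rpower 1 (alpha - INR p) = 1)
        by (unfold Rpower; rewrite ln_1, Rmult_0_r; apply exp_0).
      rewrite H1; unfold Rdiv; ring.
Qed.

(** The coefficient of t^j in (1 + u)^alpha when [c] lists those of u and [c 0 = 0]; powers p > j do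
    not reach degree j. *)
Definition binom_coef (c : nat -> R) (alpha : R) (j : nat) : R :=
  sum_f_R0 (fun p => falling alpha p / INR (fact p) * conv_pow c p j) j.

Lemma sum_f_R0_extend_0 (F : nat -> R) (j n : nat) : (j <= n)%nat ->
  (forall i, (j < i)%nat -> F i = 0) -> sum_f_R0 F n = sum_f_R0 F j.
Proof.
  intros Hj HF; induction Hj as [|n Hj IH]; [trivial|]; simpl.
  rewrite IH, HF by lia; ring.
Qed.

Lemma asym_Rpower (alpha : R) (u : R -> R) (c : nat -> R) :
  (forall N, asym N u c) -> c O = 0 -> at_right 0 (fun t => 0 < u t) ->
  forall N, asym N (fun t => Rpower (1 + u t) alpha) (binom_coef c alpha).
Proof.
  intros Hu Hc Hpos N.
  destruct (Hu 1%nat) as (v & Hv & M & HM); rewrite Hc in Hv.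
  destruct (Rpower_binomial_remainder alpha N) as [K HK].
  set (s := fun t => sum_f_R0 (fun p => falling alpha p / INR (fact p) * u t ^ p) N).
  assert (Hs : asym N s (binom_coef c alpha)).
  (* The binomial sum is cut at the common bound [N] for all degrees; in degree j < N its terms with
     p > j vanish. *)
  { apply asym_ext with s
      (fun j => sum_f_R0 (fun p => falling alpha p / INR (fact p) * conv_pow c p j) N).
    - now apply filter_forall.
    - intros j Hj; apply sum_f_R0_extend_0; [lia|].
      intros i Hi; rewrite conv_pow_low by trivial; ring.
    - apply asym_sum; intros p; apply asym_scal, asym_pow, Hu. }
  (* [L] gives u t <= L t. Below 1 / L this puts u t in (0, 1), where the binomial remainder bound
     holds, and that remainder is then at most |K| L^(N+1) t^N. *)
  set (L := Rabs M + 1).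
  assert (HL : 0 < L) by (unfold L; generalize (Rabs_pos M); lra).
  assert (Hr : asym N (fun t => Rpower (1 + u t) alpha - s t) (fun _ => 0)).
  { apply asym_small with (Rabs K * L ^ S N).
    assert (HL' : 0 < / L) by now apply Rinv_0_lt_compat.
    generalize (filter_and _ _ (filter_and _ _ Hv HM) (filter_and _ _ Hpos
      (filter_and _ _ (at_right_0_interval _ HL') (at_right_0_interval 1 Rlt_0_1)))).
    apply filter_imp; intros t ((Hut & HvM) & H0 & Ht & Ht1).
    assert (Hle : u t <= L * t).
    { rewrite Hut, Rplus_0_l, Rmult_comm; apply Rmult_le_compat_r; [lra|].
      unfold L; generalize (Rle_abs (v t)) (Rle_abs M); lra. }
    assert (H1 : L * t < 1).
    { replace 1 with (L * / L) by (field; lra); apply Rmult_lt_compat_l; lra. }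
    eapply Rle_trans; [apply HK; lra|].
    rewrite Rmult_assoc.
    assert (HuN : 0 <= u t ^ S N <= L ^ S N * t ^ N).
    { split; [apply pow_le; lra|].
      apply Rle_trans with ((L * t) ^ S N); [apply pow_incr; lra|].
      rewrite Rpow_mult_distr; apply Rmult_le_compat_l; [apply pow_le; lra|].
      simpl; generalize (pow_le t N ltac:(lra)); nra. }
    apply Rle_trans with (Rabs K * u t ^ S N).
    - apply Rmult_le_compat_r; [apply HuN|apply Rle_abs].
    - apply Rmult_le_compat_l; [apply Rabs_pos|apply HuN]. }
  generalize (asym_plus _ _ _ _ _ Hs Hr); apply asym_ext.
  - apply filter_forall; intros t; ring.
  - intros n _; ring.
Qed.

(* Coefficients of [(1 + u)^beta * sum_k b_k (t (1 + u))^k] when [c] are those of [u]; factoring out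
   [t (1 + u)] shifts [b] and raises [beta] by one. *)
Fixpoint twisted_coef (c : nat -> R) (beta : R) (b : nat -> R) (n : nat) : R :=
  match n with
  | O => b O * binom_coef c beta O
  | S n' => b O * binom_coef c beta n + twisted_coef c (beta + 1) (fun k => b (S k)) n'
  end.

Lemma asym_Rpower_PSeries (u : R -> R) (c : nat -> R) :
  (forall N, asym N u c) -> c O = 0 -> at_right 0 (fun t => 0 < u t) ->
  forall N beta b, Rbar_lt 0 (CV_radius b) ->
  asym N (fun t => Rpower (1 + u t) beta * PSeries b (t * (1 + u t))) (twisted_coef c beta b).
Proof.
  intros Hu Hc Hpos.
  (* As u is bounded, t (1 + u) tends to 0 and eventually enters the disk where the series of [b]
     converges. *)
  assert (Hxi : forall e, 0 < e -> at_right 0 (fun t => Rabs (t * (1 + u t)) < e)).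
  { intros e He; destruct (Hu O) as [M HM].
    set (L := 1 + Rabs M).
    assert (HL : 0 < L) by (unfold L; generalize (Rabs_pos M); lra).
    assert (HeL : 0 < e / L) by now apply Rdiv_lt_0_compat.
    generalize (filter_and _ _ HM (filter_and _ _ Hpos (at_right_0_interval _ HeL))).
    apply filter_imp; intros t (H1 & H2 & Ht).
    assert (Hle : 1 + u t <= L)
      by (unfold L; generalize (Rle_abs (u t)) (Rle_abs M); lra).
    rewrite Rabs_pos_eq by nra.
    apply Rle_lt_trans with (t * L); [apply Rmult_le_compat_l; lra|].
    replace e with (e / L * L) by (field; lra); apply Rmult_lt_compat_r; lra. }
  induction N as [|N IH]; intros beta b Hb.
  - destruct (PSeries_bounded_near_0 b Hb) as (M & e & He & H).
    apply (asym_mult 0 _ _ (binom_coef c beta) b); [now apply asym_Rpower|].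
    exists M; generalize (Hxi e He); apply filter_imp; intros t; apply H.
  - destruct (ex_pseries_near_0 b Hb) as (e & He & H).
    apply asym_ext with
      (fun t => b O * Rpower (1 + u t) beta
        + t * (Rpower (1 + u t) (beta + 1) * PSeries (PS_decr_1 b) (t * (1 + u t))))
      (fun n => b O * binom_coef c beta n
        + match n with O => 0 | S n' => twisted_coef c (beta + 1) (PS_decr_1 b) n' end).
    + generalize (filter_and _ _ Hpos (Hxi e He)); apply filter_imp; intros t [Hp Ht].
      rewrite (PSeries_decr_1 b) by now apply H.
      rewrite Rpower_plus, Rpower_1 by lra; ring.
    + intros [|n] _; simpl; [ring|reflexivity].
    + apply asym_plus.
      * apply asym_scal, asym_Rpower; trivial.
      * exists (fun t => Rpower (1 + u t) (beta + 1) * PSeries (PS_decr_1 b) (t * (1 + u t))).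
        split; [apply filter_forall; intros t; ring|].
        apply IH; now rewrite CV_radius_decr_1.
Qed.

Lemma twisted_coef_sum (c : nat -> R) (n : nat) : forall beta b,
  twisted_coef c beta b n =
  sum_f_R0 (fun j => b (n - j)%nat * binom_coef c (beta + INR (n - j)) j) n.
Proof.
  induction n as [|n IH]; intros beta b.
  - simpl; now rewrite Rplus_0_r.
  (* The head of the recursion, where [b] has index 0, is the last term j = S n of the sum. *)
  - cbn [twisted_coef]; rewrite IH, tech5, Nat.sub_diag, Rplus_comm; simpl (INR 0).
    rewrite Rplus_0_r; f_equal.
    apply sum_eq; intros j Hj.
    replace (S n - j)%nat with (S (n - j)) by lia.
    rewrite S_INR; do 2 f_equal; ring.
Qed.

(** * Bell polynomials *)

Definition lsum {A : Type} (F : A -> R) (L : list A) : R := fold_right Rplus 0 (map F L).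

Lemma lsum_ext {A : Type} (F G : A -> R) (L : list A) :
  (forall k, F k = G k) -> lsum F L = lsum G L.
Proof.
  intros H; unfold lsum; now rewrite (map_ext F G H).
Qed.

Lemma lsum_app {A : Type} (F : A -> R) (L L' : list A) : lsum F (L ++ L') = lsum F L + lsum F L'.
Proof.
  unfold lsum; induction L as [|k L IH]; simpl; [ring|rewrite IH; ring].
Qed.

Lemma lsum_map {A B : Type} (F : B -> R) (h : A -> B) (L : list A) :
  lsum F (map h L) = lsum (fun k => F (h k)) L.
Proof.
  unfold lsum; now rewrite map_map.
Qed.

Lemma lsum_flat_map {A B : Type} (F : B -> R) (h : A -> list B) (L : list A) :
  lsum F (flat_map h L) = lsum (fun k => lsum F (h k)) L.
Proof.
  induction L as [|k L IH]; [reflexivity|]; simpl flat_map; rewrite lsum_app, IH; reflexivity.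
Qed.

Lemma lsum_scal {A : Type} (r : R) (F : A -> R) (L : list A) :
  lsum (fun k => r * F k) L = r * lsum F L.
Proof.
  unfold lsum; induction L as [|k L IH]; simpl; [ring|rewrite IH; ring].
Qed.

Lemma lsum_filter {A : Type} (P : A -> bool) (F : A -> R) (L : list A) :
  lsum F (filter P L) = lsum (fun k => if P k then F k else 0) L.
Proof.
  unfold lsum; induction L as [|k L IH]; simpl; [reflexivity|].
  destruct (P k); simpl; rewrite IH; ring.
Qed.

Lemma lsum_seq (F : nat -> R) (n : nat) : lsum F (seq 0 (S n)) = sum_f_R0 F n.
Proof.
  induction n as [|n IH]; [unfold lsum; simpl; ring|].
  rewrite seq_S, lsum_app, IH; unfold lsum; simpl; ring.
Qed.

Lemma lsum_seq_delta (F : nat -> R) (n len : nat) : forall s,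
  lsum (fun i => if Nat.eqb i n then F i else 0) (seq s len)
  = if andb (Nat.leb s n) (Nat.ltb n (s + len)) then F n else 0.
Proof.
  unfold lsum; induction len as [|len IH]; intros s.
  - simpl; destruct (Nat.leb_spec s n), (Nat.ltb_spec n (s + 0)); simpl; trivial; lia.
  - simpl; rewrite IH.
    destruct (Nat.eqb_spec s n), (Nat.leb_spec (S s) n), (Nat.leb_spec s n),
      (Nat.ltb_spec n (S s + len)), (Nat.ltb_spec n (s + S len)); subst; simpl; try lia; ring.
Qed.

(** The multinomial theorem divided by p!, obtained from the binomial theorem by adding one variable
    at a time. The hypothesis p <= b ensures that the bound on the entries discards no vector of sum
    p. *)
Lemma kvecs_multinomial (x : nat -> R) (t : R) (b len : nat) : forall i0 p, (p <= b)%nat ->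
  lsum (fun k => if Nat.eqb (ksum k) p then kmon x i0 k / kden i0 k * t ^ kwsum i0 k else 0)
    (kvecs len b)
  = lsum (fun i => x i / INR (fact i) * t ^ i) (seq i0 len) ^ p / INR (fact p).
Proof.
  induction len as [|len IH]; intros i0 p Hp.
  - unfold lsum; simpl; destruct p as [|p]; simpl; [field|].
    unfold Rdiv; rewrite !Rmult_0_l; ring.
  - cbn [kvecs]; rewrite lsum_flat_map, lsum_seq.
    set (y := x i0 / INR (fact i0) * t ^ i0).
    set (Q := lsum (fun i => x i / INR (fact i) * t ^ i) (seq (S i0) len)).
    (* Fixing the first entry c leaves vectors of sum p - c, which the induction hypothesis handles;
       there are none when c > p. *)
    assert (Hterm : forall c, lsum
        (fun k => if Nat.eqb (ksum k) p then kmon x i0 k / kden i0 k * t ^ kwsum i0 k else 0)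
        (map (cons c) (kvecs len b))
      = if Nat.leb c p then y ^ c / INR (fact c) * (Q ^ (p - c) / INR (fact (p - c))) else 0).
    { intros c; rewrite lsum_map; destruct (Nat.leb_spec c p) as [Hc|Hc].
      - unfold Q; rewrite <- IH by lia; rewrite <- lsum_scal.
        apply lsum_ext; intros k; simpl ksum.
        destruct (Nat.eqb_spec (c + ksum k) p), (Nat.eqb_spec (ksum k) (p - c)); try lia; [|ring].
        simpl kmon; simpl kden; simpl kwsum; unfold y, Rdiv.
        rewrite pow_add, (pow_mult t i0 c), !Rpow_mult_distr, !Rinv_mult, pow_inv; ring.
      - rewrite (lsum_ext _ (fun _ => 0 * 0)).
        + rewrite lsum_scal; ring.
        + intros k; simpl ksum; destruct (Nat.eqb_spec (c + ksum k) p); [lia|ring]. }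
    rewrite (sum_eq _ _ b (fun c _ => Hterm c)).
    rewrite (sum_f_R0_extend_0 _ p b Hp).
    + change (lsum _ (seq i0 (S len))) with (y + Q); rewrite binomial.
      unfold Rdiv at 3; rewrite Rmult_comm, scal_sum.
      apply sum_eq; intros c Hc; rewrite (proj2 (Nat.leb_le c p) Hc).
      unfold Binomial.C; field; repeat split; apply INR_fact_neq_0.
    + intros c Hc; destruct (Nat.leb_spec c p); [lia|reflexivity].
Qed.

Lemma asym_monomial (N : nat) : forall (w : R) (e : nat),
  asym N (fun t => w * t ^ e) (fun n => if Nat.eqb e n then w else 0).
Proof.
  induction N as [|N IH]; intros w e.
  - exists (Rabs w); generalize (at_right_0_interval 1 Rlt_0_1); apply filter_imp; intros t Ht.
    rewrite Rabs_mult, (Rabs_pos_eq (t ^ e)) by (apply pow_le; lra).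
    assert (t ^ e <= 1) by (rewrite <- (pow1 e); apply pow_incr; lra).
    generalize (Rabs_pos w); nra.
  - destruct e as [|e].
    + generalize (asym_const (S N) w); apply asym_ext.
      * apply filter_forall; intros t; simpl; ring.
      * now intros [|n] _.
    + exists (fun t => w * t ^ e); split; [apply filter_forall; intros t; simpl; ring|].
      apply IH.
Qed.

Lemma asym_lsum_monomials {A : Type} (N : nat) (w : A -> R) (e : A -> nat) (L : list A) :
  asym N (fun t => lsum (fun k => w k * t ^ e k) L)
    (fun n => lsum (fun k => if Nat.eqb (e k) n then w k else 0) L).
Proof.
  induction L as [|k L IH].
  - apply asym_small with 0; apply filter_forall; intros t; unfold lsum; simpl; rewrite Rabs_R0; lra.
  - exact (asym_plus _ _ _ _ _ (asym_monomial N (w k) (e k)) IH).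
Qed.

(* Both sides are, up to [p!], the coefficient of [t^j] in [(sum_{1 <= i <= j} x_i t^i / i!)^p]. *)
Lemma bell_conv_pow (x c : nat -> R) (j p : nat) : c O = 0 ->
  (forall i, c (S i) = x (S i) / INR (fact (S i))) -> (p <= j)%nat ->
  bell j p x / INR (fact j) = conv_pow c p j / INR (fact p).
Proof.
  intros Hc0 Hc Hp.
  (* Order [S j] sees degrees up to j only, so cutting the generating polynomial at i = j loses
     nothing. *)
  set (q := fun t => lsum (fun i => x i / INR (fact i) * t ^ i) (seq 1 j)).
  assert (Hq : asym (S j) q c).
  { generalize (asym_lsum_monomials (S j) (fun i => x i / INR (fact i)) (fun i => i) (seq 1 j)).
    apply asym_ext; [now apply filter_forall|].
    intros n Hn; rewrite lsum_seq_delta.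
    destruct n as [|n]; [now rewrite Hc0|rewrite Hc].
    destruct (Nat.ltb_spec (S n) (1 + j)); [reflexivity|lia]. }
  assert (Hl := asym_lsum_monomials (S j) (fun k => kmon x 1 k / kden 1 k) (kwsum 1)
    (filter (fun k => Nat.eqb (ksum k) p) (kvecs j j))).
  apply (asym_scal _ (INR (fact p))) in Hl.
  assert (Hq' : asym (S j) (fun t => q t ^ p) (fun n => INR (fact p) *
     lsum (fun k => if Nat.eqb (kwsum 1 k) n then kmon x 1 k / kden 1 k else 0)
       (filter (fun k => Nat.eqb (ksum k) p) (kvecs j j)))).
  { revert Hl; apply asym_ext; [|trivial]; apply filter_forall; intros t.
    rewrite lsum_filter, kvecs_multinomial by trivial; fold (q t).
    field; apply INR_fact_neq_0. }
  (* The coefficient of t^j in q^p, computed by Cauchy products and by the multinomial expansion. *)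
  rewrite (asym_unique _ _ _ _ (asym_pow _ p _ _ Hq) Hq' j (Nat.lt_succ_diag_r j)).
  unfold bell; fold (lsum (fun k => INR (fact j) / kden 1 k * kmon x 1 k)
    (filter (fun k => andb (Nat.eqb (ksum k) p) (Nat.eqb (kwsum 1 k) j)) (kvecs j j))).
  rewrite (lsum_ext _ (fun k => INR (fact j) * (kmon x 1 k / kden 1 k)))
    by (intros k; unfold Rdiv; ring).
  rewrite lsum_scal, !lsum_filter.
  rewrite (lsum_ext (fun k => if Nat.eqb (ksum k) p then _ else 0)
    (fun k => if andb (Nat.eqb (ksum k) p) (Nat.eqb (kwsum 1 k) j)
              then kmon x 1 k / kden 1 k else 0))
    by (intros k; now destruct (Nat.eqb (ksum k) p)).
  field; split; apply INR_fact_neq_0.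
Qed.

(** * The coefficients d_n *)

Definition log_coef (i : nat) : R := match i with O => 0 | S _ => / INR (S i) end.

Lemma asym_log_quotient (N : nat) : asym N (fun t => - ln (1 - t) / t - 1) log_coef.
Proof.
  generalize (asym_plus _ _ _ _ _ (asym_ln N) (asym_const N (-1))).
  apply asym_ext; [apply filter_forall; intros t; ring|].
  intros [|n] _; unfold log_coef; [simpl; field|ring].
Qed.

(** This is the positivity of u near 0+ that [asym_Rpower] requires; it rests on 1 - t < e^{-t}. *)
Lemma neg_ln_gt (t : R) : 0 < t < 1 -> t < - ln (1 - t).
Proof.
  intros Ht; apply exp_lt_inv.
  rewrite exp_Ropp, exp_ln by lra.
  rewrite <- (Rinv_inv (exp t)); apply Rinv_lt_contravar.
  - apply Rmult_lt_0_compat; [lra|apply Rinv_0_lt_compat, exp_pos].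
  - rewrite <- exp_Ropp; generalize (exp_ineq1 (- t)); lra.
Qed.

Lemma sum_f_R0_split_first (F : nat -> R) (n : nat) :
  sum_f_R0 F n = F O + sum_n_m F 1 n.
Proof.
  rewrite <- sum_n_Reals; unfold sum_n; now rewrite sum_Sn_m by lia.
Qed.

Lemma bell_arg_conv_pow (j p : nat) : (p <= j)%nat ->
  bell j p bell_arg / INR (fact j) = conv_pow log_coef p j / INR (fact p).
Proof.
  apply bell_conv_pow; [reflexivity|].
  intros i; unfold bell_arg, log_coef; field.
  split; [apply not_0_INR; lia|apply INR_fact_neq_0].
Qed.

(** Dividing by Gamma rho turns each falling product into a value of [rgamma], and the powers of u
    into Bell polynomials; the factor Gamma (rho + j) inside [drj] is compensated on the right. *)
Lemma binom_coef_drj (rho : R) (j : nat) : 0 < rho -> (1 <= j)%nat ->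
  binom_coef log_coef (rho - 1) j / Gamma rho = / Gamma (rho + INR j) * drj rho j.
Proof.
  intros Hr Hj.
  assert (HG : 0 < Gamma rho) by now apply Gamma_pos.
  assert (HGj : 0 < Gamma (rho + INR j)) by (apply Gamma_pos; generalize (pos_INR j); lra).
  unfold binom_coef; rewrite sum_f_R0_split_first.
  (* The term p = 0 is the coefficient of t^j in the constant 1, hence 0 for j >= 1; this is why the
     sum in [drj] starts at p = 1. *)
  destruct j as [|j]; [lia|]; simpl conv_pow at 1; rewrite Rmult_0_r, Rplus_0_l.
  set (J := S j) in *; unfold drj.
  assert (Hs : sum_n_m (fun p => falling (rho - 1) p / INR (fact p) * conv_pow log_coef p J) 1 J
    = Gamma rho / INR (fact J) * sum_n_m (fun p => bell J p bell_arg * rgamma (rho - INR p)) 1 J).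
  { change (Gamma rho / INR (fact J) * ?s) with (mult (K := R_AbsRing) (Gamma rho / INR (fact J)) s).
    rewrite <- (sum_n_m_mult_l (K := R_AbsRing)); apply sum_n_m_ext_loc; intros p Hp.
    change (falling (rho - 1) p / INR (fact p) * conv_pow log_coef p J
      = Gamma rho / INR (fact J) * (bell J p bell_arg * rgamma (rho - INR p))).
    rewrite rgamma_falling by trivial.
    transitivity (falling (rho - 1) p * (conv_pow log_coef p J / INR (fact p)));
      [unfold Rdiv; ring|].
    rewrite <- bell_arg_conv_pow by lia.
    field; split; [lra|apply INR_fact_neq_0]. }
  rewrite Hs; field; repeat split; try lra; apply INR_fact_neq_0.
Qed.

(** This treats one class of indices l + m k, with r = l / m; [A] and [D] are meant to be real or
    imaginary parts of a and d along it. Two expansions of the same function of t are compared. *)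
Lemma real_coefficients (r e : R) (A D : nat -> R) : 0 < r -> 0 < e <= 1 ->
  (forall t, 0 < t < e -> exists s,
     is_pseries (fun k => A k / Gamma (r + INR k)) (- ln (1 - t)) s /\
     is_pseries D t (Rpower (- ln (1 - t) / t) (r - 1) * s)) ->
  forall n, D n = / Gamma (r + INR n) *
    (A n + sum_n_m (fun j => drj (r + INR (n - j)) j * A (n - j)%nat) 1 n).
Proof.
  intros Hr He H n.
  set (b := fun k => A k / Gamma (r + INR k)) in *.
  set (u := fun t => - ln (1 - t) / t - 1).
  (* Convergence at one positive point is enough for both series to have a positive radius. *)
  assert (Hmid : 0 < e / 2 < e) by lra.
  destruct (H _ Hmid) as (s0 & Hb0 & HD0).
  assert (Hb : Rbar_lt 0 (CV_radius b)).
  { apply CV_radius_pos_of_is_pseries with (2 := Hb0); generalize (neg_ln_gt (e / 2)); lra. }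
  assert (HD : Rbar_lt 0 (CV_radius D)) by (apply CV_radius_pos_of_is_pseries with (2 := HD0); lra).
  assert (Hu : at_right 0 (fun t => 0 < u t)).
  { generalize (at_right_0_interval 1 Rlt_0_1); apply filter_imp; intros t Ht; unfold u.
    assert (Hl := neg_ln_gt t Ht).
    apply Rlt_0_minus, Rmult_lt_reg_r with t; [lra|].
    unfold Rdiv; rewrite Rmult_assoc, Rinv_l, Rmult_1_l, Rmult_1_r by lra; exact Hl. }
  assert (HA1 := asym_PSeries (S n) D HD).
  assert (HA2 := asym_Rpower_PSeries u log_coef asym_log_quotient eq_refl Hu (S n) (r - 1) b Hb).
  assert (HA3 : asym (S n) (PSeries D) (twisted_coef log_coef (r - 1) b)).
  { revert HA2; apply asym_ext; [|trivial].
    generalize (at_right_0_interval e (proj1 He)); apply filter_imp; intros t Ht.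
    destruct (H t Ht) as (s & Hs1 & Hs2).
    rewrite (is_pseries_unique _ _ _ Hs2); unfold u.
    replace (1 + (- ln (1 - t) / t - 1)) with (- ln (1 - t) / t) by ring.
    replace (t * (- ln (1 - t) / t)) with (- ln (1 - t)) by (field; lra).
    now rewrite (is_pseries_unique _ _ _ Hs1). }
  rewrite (asym_unique _ _ _ _ HA1 HA3 n (Nat.lt_succ_diag_r n)).
  rewrite twisted_coef_sum, sum_f_R0_split_first, Rmult_plus_distr_l; f_equal.
  (* The term j = 0 carries the binomial coefficient 1 and gives the isolated [A n]. *)
  - rewrite Nat.sub_0_r; unfold b, binom_coef; simpl; field.
    apply Rgt_not_eq, Gamma_pos; generalize (pos_INR n); lra.
  - change (/ Gamma (r + INR n) * ?s) with (mult (K := R_AbsRing) (/ Gamma (r + INR n)) s).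
    rewrite <- (sum_n_m_mult_l (K := R_AbsRing)); apply sum_n_m_ext_loc; intros j Hj.
    change (b (n - j)%nat * binom_coef log_coef (r - 1 + INR (n - j)) j
      = / Gamma (r + INR n) * (drj (r + INR (n - j)) j * A (n - j)%nat)).
    assert (Hp : 0 < r + INR (n - j)) by (generalize (pos_INR (n - j)); lra).
    replace (r - 1 + INR (n - j)) with (r + INR (n - j) - 1) by ring.
    transitivity (A (n - j)%nat *
      (binom_coef log_coef (r + INR (n - j) - 1) j / Gamma (r + INR (n - j))));
      [unfold b, Rdiv; ring|].
    rewrite binom_coef_drj by (trivial; lia).
    rewrite minus_INR by lia.
    replace (r + (INR n - INR j) + INR j) with (r + INR n) by ring; ring.
Qed.

(** * From complex to real series *)

Lemma cexp_RtoC (x : R) : cexp (RtoC x) = RtoC (exp x).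
Proof.
  unfold cexp, RtoC; simpl; rewrite cos_0, sin_0; f_equal; ring.
Qed.

Lemma clog_RtoC (x : R) : 0 < x -> clog (RtoC x) = RtoC (ln x).
Proof.
  intros Hx; unfold clog, carg; rewrite Cmod_R, Rabs_pos_eq by lra.
  unfold RtoC; simpl; destruct (Rlt_dec 0 x); [|lra].
  unfold Rdiv; now rewrite Rmult_0_l, atan_0.
Qed.

Lemma cpow_RtoC (x alpha : R) : 0 < x -> cpow (RtoC x) alpha = RtoC (Rpower x alpha).
Proof.
  intros Hx; unfold cpow; rewrite clog_RtoC, <- RtoC_mult by trivial; apply cexp_RtoC.
Qed.

(** What [Re] and [Im] share: additivity, compatibility with real factors and continuity. Stating it
    abstractly lets the real argument run once for both. *)
Definition real_projection (pr : C -> R) : Prop :=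
  (forall z w, pr (z + w)%C = pr z + pr w) /\
  (forall z x, pr (z * RtoC x)%C = pr z * x) /\
  (forall l, continuous (T := C_UniformSpace) (U := R_UniformSpace) pr l).

Lemma real_projection_Re : real_projection Re.
Proof.
  split; [reflexivity|split].
  - intros [x y] z; simpl; ring.
  - intros l; apply (continuous_fst (U := R_UniformSpace) (V := R_UniformSpace)).
Qed.

Lemma real_projection_Im : real_projection Im.
Proof.
  split; [reflexivity|split].
  - intros [x y] z; simpl; ring.
  - intros l; apply (continuous_snd (U := R_UniformSpace) (V := R_UniformSpace)).
Qed.

Lemma real_projection_0 (pr : C -> R) : real_projection pr -> pr (RtoC 0) = 0.
Proof.
  intros (_ & H & _); rewrite <- (Cmult_0_r (RtoC 0)), H; ring.
Qed.

Lemma real_projection_sum_n_m (pr : C -> R) (F : nat -> C) (n m : nat) : real_projection pr ->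
  pr (sum_n_m F n m) = sum_n_m (fun k => pr (F k)) n m.
Proof.
  intros Hpr; unfold sum_n_m, Iter.iter_nat.
  induction (seq.iota n (S m - n)) as [|k L IH]; simpl.
  - now apply real_projection_0.
  - exact (eq_trans (proj1 Hpr _ _) (f_equal (Rplus (pr (F k))) IH)).
Qed.

Lemma real_projection_series (pr : C -> R) (F : nat -> C) (l : C) : real_projection pr ->
  is_series (K := C_AbsRing) (V := C_NormedModule) F l -> is_series (fun k => pr (F k)) (pr l).
Proof.
  intros Hpr HF.
  apply (filterlim_ext (fun n => pr (sum_n F n))).
  - intros n; now apply real_projection_sum_n_m.
  - apply filterlim_comp with (1 := HF); apply Hpr.
Qed.

Theorem proposition5p5
  (m : nat) (Hm : (1 <= m)%nat) (a : nat -> C)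
  (* f is Gevrey-1 *)
  (Hgev : exists Cc K : R, forall n : nat,
      Cmod (a n) <= Cc * K ^ n * Gamma (1 + INR n / INR m))
  (* the Borel transform extends analytically to Omega* with the exponential bound *)
  (Hborel : exists (F : C -> C) (A B : R), 0 < A /\ 0 < B /\
      (forall w : C, F (Cplus w (0, 2 * PI * INR m)) = F w) /\
      (forall w : C, Omega_star w -> ex_derive (K := C_AbsRing) (V := C_NormedModule) F w) /\
      (exists r : R, 0 < r /\ forall w : C, Re w < ln r ->
          is_series (K := C_AbsRing) (V := C_NormedModule)
            (fun n : nat => if Nat.eqb n 0 then RtoC 0 else
               (a n * cexp (RtoC (INR n / INR m - 1) * w) / RtoC (Gamma (INR n / INR m)))%C)
            (F w)) /\
      (forall w : C, Omega_star w ->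
          Cmod (F w) * exp ((INR m - 1) / INR m * Re w) <= A * exp (B * exp (Re w))))
  (d : nat -> C)
  (* definition of the d_n through the g_l *)
  (Hd : forall l : nat, (1 <= l <= m)%nat ->
      exists g : C -> C,
        (forall xi : C, DeltaSet xi -> ex_derive (K := C_AbsRing) (V := C_NormedModule) g xi) /\
        (exists rho : R, 0 < rho /\ forall xi : C, 0 < Cmod xi < rho ->
           exists S : C,
             is_series (K := C_AbsRing) (V := C_NormedModule)
               (fun k : nat => (a (l + m * k)%nat * xi ^ k
                                / RtoC (Gamma (INR l / INR m + INR k)))%C) S /\
             g xi = (cpow (xi / (1 - cexp (- xi)))%C (INR l / INR m - 1) * S)%C) /\
        (forall s : C, D11 s ->
           is_series (K := C_AbsRing) (V := C_NormedModule)
             (fun j : nat => (d (l + m * j)%nat * (1 - s) ^ j)%C) (g (- clog s)%C))) :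
  forall n : nat, (1 <= n)%nat ->
    d n = (RtoC (/ Gamma (INR n / INR m)) *
           (a n + sum_n_m (fun j : nat =>
                    if Nat.ltb (j * m) n
                    then (RtoC (drj (INR (n - j * m) / INR m) j) * a (n - j * m)%nat)%C
                    else RtoC 0) 1 n))%C.
Proof.
  intros n Hn.
  (* Dividing n - 1 rather than n puts the remainder l in 1..m instead of 0..m-1. *)
  assert (Hlq : exists l q, (1 <= l <= m)%nat /\ n = (l + m * q)%nat).
  { exists (S ((n - 1) mod m)), ((n - 1) / m)%nat.
    generalize (Nat.mod_upper_bound (n - 1) m) (Nat.div_mod_eq (n - 1) m); lia. }
  destruct Hlq as (l & q & Hl & Hnq).
  destruct (Hd l Hl) as (g & _ & (rho & Hrho & Hg) & Hs).
  assert (HmR : 0 < INR m) by (apply lt_0_INR; lia).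
  assert (HlR : 0 < INR l) by (apply lt_0_INR; lia).
  set (r := INR l / INR m) in *.
  assert (Hr : 0 < r) by now apply Rdiv_lt_0_compat.
  assert (Hfrac : forall k, INR (l + m * k) / INR m = r + INR k)
    by (intros k; rewrite plus_INR, mult_INR; unfold r; field; lra).
  assert (HG : forall k, 0 < Gamma (r + INR k))
    by (intros k; apply Gamma_pos; generalize (pos_INR k); lra).
  (* Chosen so that t < e is equivalent to -ln (1 - t) < rho, the range in which g is given by its
     formula near 0. *)
  set (e := 1 - exp (- rho)).
  assert (He : 0 < e <= 1).
  { unfold e; generalize (exp_pos (- rho)); split; [|lra].
    enough (exp (- rho) < exp 0) by (rewrite exp_0 in *; lra).
    apply exp_increasing; lra. }
  assert (Hmain : forall pr, real_projection pr -> pr (d n) =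
    / Gamma (r + INR q) * (pr (a n) +
      sum_n_m (fun j => drj (r + INR (q - j)) j * pr (a (l + m * (q - j))%nat)) 1 q)).
  { intros pr Hpr; rewrite Hnq.
    apply (real_coefficients r e (fun k => pr (a (l + m * k)%nat))
      (fun j => pr (d (l + m * j)%nat))); trivial.
    (* The point s = 1 - t of D(1,1) is used: 1 - s = t is the variable of the d-series, and xi that
       of the a-series. *)
    intros t Ht; set (xi := - ln (1 - t)).
    assert (Hxi : t < xi) by (apply neg_ln_gt; lra).
    assert (Hxir : xi < rho).
    { apply exp_lt_inv; unfold xi; rewrite exp_Ropp, exp_ln by lra.
      rewrite <- (Rinv_inv (exp rho)), <- exp_Ropp.
      apply Rinv_lt_contravar; [|unfold e in Ht; lra].
      apply Rmult_lt_0_compat; [apply exp_pos|lra]. }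
    destruct (Hg (RtoC xi)) as (s & Hs1 & Hs2); [rewrite Cmod_R, Rabs_pos_eq; lra|].
    exists (pr s); split.
    - apply is_pseries_R.
      eapply is_series_ext; [|exact (real_projection_series pr _ _ Hpr Hs1)].
      intros k; simpl.
      unfold Cdiv.
      rewrite <- RtoC_pow, <- RtoC_inv, <- Cmult_assoc, <- RtoC_mult by (generalize (HG k); lra).
      rewrite (proj1 (proj2 Hpr)); unfold Rdiv; ring.
    - apply is_pseries_R.
      assert (HD : D11 (RtoC (1 - t))).
      { unfold D11; rewrite <- RtoC_minus, Cmod_R.
        replace (1 - t - 1) with (- t) by ring; rewrite Rabs_Ropp, Rabs_pos_eq; lra. }
      assert (Hst := real_projection_series pr _ _ Hpr (Hs _ HD)).
      rewrite clog_RtoC, <- RtoC_opp in Hst by lra; fold xi in Hst.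
      rewrite Hs2, <- RtoC_opp, cexp_RtoC in Hst.
      unfold xi at 2 in Hst; rewrite Ropp_involutive, exp_ln in Hst by lra.
      rewrite <- RtoC_minus in Hst.
      replace (1 - (1 - t)) with t in Hst by ring.
      rewrite <- RtoC_div, cpow_RtoC in Hst by (try apply Rdiv_lt_0_compat; lra).
      rewrite Cmult_comm, (proj1 (proj2 Hpr)), Rmult_comm in Hst.
      eapply is_series_ext; [|exact Hst].
      intros k; simpl.
      now rewrite <- RtoC_pow, (proj1 (proj2 Hpr)). }
  assert (Hrhs : forall pr, real_projection pr -> pr (d n) = pr (RtoC (/ Gamma (INR n / INR m)) *
           (a n + sum_n_m (fun j : nat =>
                    if Nat.ltb (j * m) n
                    then (RtoC (drj (INR (n - j * m) / INR m) j) * a (n - j * m)%nat)%C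
                    else RtoC 0) 1 n))%C).
  { intros pr Hpr; rewrite Hmain by trivial.
    rewrite Cmult_comm, (proj1 (proj2 Hpr)), (proj1 Hpr), real_projection_sum_n_m by trivial.
    replace (INR n / INR m) with (r + INR q) by (rewrite Hnq; symmetry; apply Hfrac).
    rewrite (Rmult_comm (/ Gamma _)); f_equal; f_equal.
    (* As 1 <= l <= m, the condition j m < n = l + m q amounts to j <= q; the terms from S q to n
       are the zero default. *)
    assert (Hqn : (q <= n)%nat) by nia.
    rewrite (sum_n_m_Chasles _ 1 q n) by lia.
    rewrite (sum_n_m_ext_loc _ (fun _ => 0) (S q) n).
    - change 0 with (zero (G := R_AbelianMonoid)); rewrite sum_n_m_const_zero.
      rewrite plus_zero_r.
      apply sum_n_m_ext_loc; intros j Hj.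
      rewrite (proj2 (Nat.ltb_lt (j * m) n)) by nia.
      replace (n - j * m)%nat with (l + m * (q - j))%nat by nia.
      now rewrite Hfrac, Cmult_comm, (proj1 (proj2 Hpr)), Rmult_comm.
    - intros j Hj; destruct (Nat.ltb_spec (j * m) n); [nia|].
      now apply real_projection_0. }
  apply injective_projections.
  - apply (Hrhs Re), real_projection_Re.
  - apply (Hrhs Im), real_projection_Im.
Qed.
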